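(* Let $\{X_k:k\ge 1\}$ be a sequence of i.i.d. $\mathcal{M}$-valued random variables, distributed as $X$, with finite variance $\sigma_d^2(X)<\infty$. Then $$S_n=H\Big(\frac1n\sum_{k=1}^n h(X_k)\Big)\longrightarrow E_d[X]\quad\text{in probability as } n\to\infty.$$
   Context: $\phi:\mathcal{J}\to\mathbb{R}$ is a strictly convex, three times continuously differentiable function with $\phi''>0$ on a bounded or unbounded interval $\mathcal{J}\subset\mathbb{R}$, and $\mathcal{M}=\mathcal{J}^K$. The function $h:\mathcal{J}\to\mathbb{R}$ is a primitive of $(\phi'')^{1/2}$ and $H=h^{-1}$ is its compositional inverse on $h(\mathcal{J})$; both act componentwise on vectors. $\mathcal{M}$ carries the geodesic distance $d_\phi(x,y)=\|h(x)-h(y)\|$ (Euclidean norm) of the Riemannian metric $g_{i,j}(x)=\phi''(x_i)\delta_{i,j}$. The $d$-mean of $X$ is $E_d[X]=H(E[h(X)])$, and its $d$-variance is $\sigma_d^2(X)=E[\|h(X)-h(E_d[X])\|^2]$. The sample estimator $S_n$ of the $d$-mean is the point $v\in\mathcal{M}$ minimizing $\sum_{k=1}^n d_\phi(X_k,v)^2$, which is $S_n=H\big(\frac1n\sum_{k=1}^n h(X_k)\big)$. *)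

(* Defs.v *)
(* MathComp-Analysis, over an abstract [R : realType]. *)
From HB Require Import structures.
From mathcomp Require Import all_boot all_order all_algebra.
From mathcomp Require Import all_classical all_reals all_analysis.

Set Implicit Arguments.
Unset Strict Implicit.
Unset Printing Implicit Defensive.

Import Order.TTheory GRing.Theory Num.Theory.
Import numFieldNormedType.Exports.

Local Open Scope classical_set_scope.
Local Open Scope ring_scope.

(* An interval may contain its endpoints, and a function on it is represented
   by a total function whose values outside the interval are irrelevant.
   Differentiation is therefore taken relative to the interval: limits run over
   [y] in [J] with [y != x], which gives the one-sided derivative at an endpoint
   that belongs to [J]. *)
Section CalculusOnASet.
Context {R : realType}.
Implicit Types (J : set R) (f : R -> R).

Definition difference_quotient f (x : R) : R -> R :=
  fun y => (f y - f x) / (y - x).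

Definition derivable_in J f (x : R) : Prop :=
  cvg (difference_quotient f x @ within J x^').

Definition derive_in J f : R -> R :=
  fun x => lim (difference_quotient f x @ within J x^').

Definition deriven_in J (n : nat) f : R -> R := iter n (derive_in J) f.

Definition continuously_derivable_in J (n : nat) f : Prop :=
  (forall k x, (k < n)%N -> J x -> derivable_in J (deriven_in J k f) x) /\
  {within J, continuous (deriven_in J n f)}.

Definition primitive_in J f g : Prop :=
  forall x, J x -> derivable_in J g x /\ derive_in J g x = f x.

Definition strictly_convex_in J f : Prop :=
  forall x y t, J x -> J y -> x != y -> 0 < t < 1 ->
    f (t * x + (1 - t) * y) < t * f x + (1 - t) * f y.

Definition nondegenerate_interval J : Prop :=
  is_interval J /\ exists x y, [/\ J x, J y & x < y].

End CalculusOnASet.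

(* Vectors of [R^K] are tuples, which carry the product Borel sigma-algebra. *)
Section Vectors.
Context {R : realType} {K : nat}.
Implicit Types (u v : K.-tuple R) (h : R -> R).

Definition cartesian_power (J : set R) : set (K.-tuple R) :=
  [set v | forall i, J (tnth v i)].

Definition euclidean_dist u v : R :=
  Num.sqrt (\sum_(i < K) (tnth u i - tnth v i) ^+ 2).

Definition geodesic_dist h u v : R :=
  euclidean_dist (map_tuple h u) (map_tuple h v).

Definition sample_average (n : nat) (v : nat -> K.-tuple R) : K.-tuple R :=
  [tuple n%:R^-1 * \sum_(k < n) tnth (v k) i | i < K].

End Vectors.

Section Probability.
Context {d : measure_display} {T : measurableType d} {R : realType}.
Variable P : probability T R.

Definition mean_vector {K : nat} (Y : T -> K.-tuple R) : K.-tuple R :=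
  [tuple fine 'E_P[fun t => tnth (Y t) i] | i < K].

Definition d_mean {K : nat} (h H : R -> R) (X : T -> K.-tuple R) : K.-tuple R :=
  map_tuple H (mean_vector (fun t => map_tuple h (X t))).

(* Extended-real valued.  If it is finite then [h(X)] is square integrable,
   whatever value [fine] gives to a non-finite expectation in [mean_vector]:
   the subtracted vector is constant in any case.  Hence finiteness of the
   variance already entails that [d_mean] is a genuine mean. *)
Definition d_variance {K : nat} (h H : R -> R) (X : T -> K.-tuple R) : \bar R :=
  'E_P[fun t =>
    euclidean_dist (map_tuple h (X t)) (map_tuple h (d_mean h H X)) ^+ 2].

Definition mutually_independent {d' : measure_display}
    {V : measurableType d'} (X : nat -> {RV P >-> V}) : Prop :=
  forall (I : seq nat) (A : nat -> set V), uniq I ->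
    (forall k, k \in I -> measurable (A k)) ->
    P (\bigcap_(k in [set` I]) (X k @^-1` A k)) =
      (\prod_(k <- I) P (X k @^-1` A k))%E.

Definition identically_distributed {d' : measure_display}
    {V : measurableType d'} (X Y : {RV P >-> V}) : Prop :=
  forall A, measurable A -> distribution P X A = distribution P Y A.

Definition converges_in_probability {V : Type} (dist : V -> V -> R)
    (Y : nat -> T -> V) (c : V) : Prop :=
  forall e : R, 0 < e ->
    (fun n => P [set t | e <= dist (Y n t) c]) @ \oo --> 0%E.

End Probability.

(* The estimator of size [n]; the sample is indexed from 0, so it uses
   [X 0, ..., X n.-1]. *)
Definition sample_d_mean {R : realType} {K : nat} (h H : R -> R) {T : Type}
    (X : nat -> T -> K.-tuple R) (n : nat) (t : T) : K.-tuple R :=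
  map_tuple H (sample_average n (fun k => map_tuple h (X k t))).

(* Main.v *)
Require Import Defs.
From mathcomp Require Import all_boot all_order all_algebra.
From mathcomp Require Import all_classical all_reals all_analysis.
From mathcomp Require Import measurable_realfun.
From mathcomp Require Import ring lra.

Set Implicit Arguments.
Unset Strict Implicit.
Unset Printing Implicit Defensive.

Import Order.TTheory GRing.Theory Num.Theory.
Import numFieldNormedType.Exports.

Local Open Scope classical_set_scope.
Local Open Scope ring_scope.

(** The map [h] is an isometry from the manifold onto [h(J)^K] with the
    Euclidean distance, and it carries the [d]-mean to the ordinary mean and the
    sample [d]-mean to the ordinary sample mean.  The theorem is therefore the
    weak law of large numbers for the vectors [h(X_k)], transported back by [H].

    For the weak law, each coordinate of [h(X)] is square integrable because its
    squared distance to a constant is bounded by the integrand of the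
    [d]-variance ([Lfun2_tnth]).  Independence makes the summands uncorrelated:
    the law of a pair is the product of the laws, so Fubini factors the
    expectation of the product ([expectation_mul_independent]).  The variance of
    the average of [n] terms is then [v / n], and Chebyshev's inequality
    concludes ([weak_law_of_large_numbers], [weak_law_iid]).  Convergence of the
    coordinates gives convergence of the vectors by a union bound
    ([converges_in_probability_coordinates]).

    The transport rests on two facts about [h].  Its derivative is positive on
    [J], so it is strictly increasing there ([primitive_in_lt]) and [H] is
    continuous on [h(J)] ([inverse_increasing_continuous]): this takes the
    convergence from [d_phi] to the Euclidean distance by continuous mapping.
    And [h(J)] is an interval ([continuous_image_interval]), so that sample
    averages and expectations of [h(X)] remain in [h(J)], where [h] inverts [H]
    ([average_in_interval], [expectation_in_interval]).

    Every event whose probability is taken has to be measurable for monotonicity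
    and subadditivity to apply; measurability comes from [h] and [H] being
    continuous on intervals, once they are extended by [0] outside. *)

(** * Independence and products of expectations *)

Section Independence.
Context d d' (T : measurableType d) (V : measurableType d') (R : realType).
Variable P : probability T R.

Lemma mutually_independent_pair (X : nat -> {RV P >-> V}) j k A B :
    mutually_independent X -> j != k -> measurable A -> measurable B ->
  P (X j @^-1` A `&` X k @^-1` B) = (P (X j @^-1` A) * P (X k @^-1` B))%E.
Proof.
move=> indX jk mA mB; pose C i := if i == j then A else B.
have kj : (k == j) = false by rewrite eq_sym (negbTE jk).
have := indX [:: j; k] C; rewrite /= inE jk => /(_ isT).
rewrite big_cons big_seq1 /C eqxx kj => <-; last first.
  by move=> i _; case: ifP.
congr (P _); apply/seteqP; split=> t /=.
  by move=> [At Bt] i /=; rewrite !inE => /orP[] /eqP ->; rewrite ?eqxx ?kj.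
move=> Ct; split; first by have := Ct j; rewrite /= !inE eqxx; apply.
by have := Ct k; rewrite /= !inE eqxx orbT kj; apply.
Qed.

(** The product hypothesis on rectangles says that the law of [(U, W)] agrees
    with the product of the laws of [U] and [W] on a generating pi-system, hence
    everywhere; the expectation of the product is then an iterated integral. *)
Lemma expectation_mul_independent (U W : {RV P >-> V}) (f : V -> R) :
    (forall A B, measurable A -> measurable B ->
       P (U @^-1` A `&` W @^-1` B) = (P (U @^-1` A) * P (W @^-1` B))%E) ->
    measurable_fun [set: V] f ->
    f \o U \in Lfun P 1 -> f \o W \in Lfun P 1 ->
    (f \o U) * (f \o W) \in Lfun P 1 ->
  ('E_P[((f \o U) * (f \o W))%R] = 'E_P[f \o U] * 'E_P[f \o W])%E.
Proof.
move=> indUW mf /Lfun1_integrable iU /Lfun1_integrable iW /Lfun1_integrable iUW.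
have mUW : measurable_fun [set: T] (fun t => (U t, W t)).
  exact: measurable_fun_pair.
pose UW : {RV P >-> (V * V)%type} := mfun_Sub (mem_set mUW).
pose F : (V * V)%type -> \bar R := fun z => (f z.1 * f z.2)%:E.
have mF : measurable_fun setT F.
  apply/measurable_EFinP; apply: measurable_funM;
  exact: measurableT_comp.
have mEf : measurable_fun [set: V] (EFin \o f) by exact/measurable_EFinP.
have law A : measurable A ->
    (distribution P U \x distribution P W)%E A = distribution P UW A.
  apply: product_measure_unique => B C mB mC.
  by rewrite /distribution /pushforward /= -indUW.
have iF : (distribution P UW).-integrable setT F.
  by apply: integrable_pushforward => //; rewrite preimage_setT.
have iF2 : (distribution P U \x distribution P W)%E.-integrable setT F.
  apply/integrableP; split => //.
  rewrite (@eq_measure_integral _ _ _ _ (distribution P UW)).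
    by have /integrableP[] := iF.
  by move=> A mA _; exact: law.
have ifU : (distribution P U).-integrable [set: V] (EFin \o f).
  by apply: integrable_pushforward => //; rewrite preimage_setT.
have ifW : (distribution P W).-integrable [set: V] (EFin \o f).
  by apply: integrable_pushforward => //; rewrite preimage_setT.
have EU : 'E_P[f \o U]%E = (\int[distribution P U]_x (f x)%:E)%E.
  by rewrite unlock integral_distribution.
have EW : 'E_P[f \o W]%E = (\int[distribution P W]_x (f x)%:E)%E.
  by rewrite unlock integral_distribution.
have finW : 'E_P[f \o W]%E \is a fin_num.
  by rewrite expectation_fin_num//; exact/Lfun1_integrable.
transitivity ((\int[distribution P UW]_z F z)%E : \bar R).
  by rewrite unlock integral_distribution.
rewrite -(@eq_measure_integral _ _ _ _ (distribution P UW)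
  (distribution P U \x distribution P W)%E); last by move=> A mA _; exact: law.
rewrite -integral12_prod_meas1// /fubini_F/= EU -(fineK finW).
rewrite -integralZr//; apply: eq_integral => x _.
rewrite fineK// EW -integralZl//.
Qed.

End Independence.

(** * Weak law for uncorrelated variables *)

Section WeakLaw.
Context d (T : measurableType d) (R : realType) (P : probability T R).
Implicit Types (Z : nat -> T -> R) (f : T -> R).

Lemma Lfun_sum p Z n : (1 <= p)%E ->
  (forall k, Z k \in Lfun P p) -> \sum_(k < n) Z k \in Lfun P p.
Proof. by move=> p1 LZ; apply: rpred_sum. Qed.

Lemma Lfun2_sqr_integrable f : measurable_fun [set: T] f ->
  (\int[P]_t (f t ^+ 2)%:E < +oo)%E -> f \in Lfun P 2%:E.
Proof.
move=> mf fi; rewrite inE; apply/andP; split; rewrite inE//=.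
rewrite /finite_norm unlock poweR_lty//.
by under eq_integral do rewrite /= powR_mulrn// real_normK ?num_real//.
Qed.

Lemma covariance_suml Z n f : (forall k, Z k \in Lfun P 2%:E) ->
    f \in Lfun P 2%:E ->
  covariance P (\sum_(k < n) Z k) f = (\sum_(k < n) covariance P (Z k) f)%E.
Proof.
move=> LZ Lf; elim: n => [|n IH]; first by rewrite !big_ord0 covariance_cst_l.
by rewrite !big_ord_recr /= covarianceDl ?IH// Lfun_sum// lee1n.
Qed.

Lemma variance_sum_uncorrelated Z (v : R) n : (forall k, Z k \in Lfun P 2%:E) ->
    (forall j k, j != k -> covariance P (Z j) (Z k) = 0%E) ->
    (forall k, 'V_P[Z k]%E = v%:E) ->
  'V_P[(\sum_(k < n) Z k)%R]%E = (n%:R * v)%:E.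
Proof.
move=> LZ cZ vZ; elim: n => [|n IH].
  by rewrite big_ord0 mul0r variance_cst.
rewrite big_ord_recr /= varianceD ?Lfun_sum ?lee1n//.
rewrite covariance_suml//.
have -> : (\sum_(k < n) covariance P (Z k) (Z n) = 0)%E.
  by rewrite big1// => k _; rewrite cZ// ltn_eqF.
by rewrite mule0 adde0 IH vZ -EFinD -natr1 mulrDl mul1r.
Qed.

(** Chebyshev's inequality for the average, whose variance is
    [n^-2 * (n * v) = v / n]. *)
Lemma weak_law_of_large_numbers Z (m v : R) :
    (forall k, Z k \in Lfun P 2%:E) ->
    (forall j k, j != k -> covariance P (Z j) (Z k) = 0%E) ->
    (forall k, 'E_P[Z k]%E = m%:E) -> (forall k, 'V_P[Z k]%E = v%:E) ->
  converges_in_probability P (fun x y => `|x - y|)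
    (fun n t => n%:R^-1 * \sum_(k < n) Z k t) m.
Proof.
move=> LZ cZ mZ vZ e e0.
pose S n := \sum_(k < n) Z k.
have LS n : S n \in Lfun P 2%:E by rewrite Lfun_sum ?lee1n.
have PT : P [set: T] \is a fin_num by rewrite fin_num_measure.
have ES n : 'E_P[S n]%E = (n%:R * m)%:E.
  rewrite /S; elim: n {LS} => [|n IH].
    by rewrite big_ord0 mul0r expectation_cst.
  rewrite big_ord_recr/= expectationD ?IH ?mZ ?Lfun_subset12 ?Lfun_sum ?lee1n//.
  by rewrite -EFinD -natr1 mulrDl mul1r.
have avgE n : (fun t => n%:R^-1 * \sum_(k < n) Z k t) = n%:R^-1 \o* S n.
  by apply/funext => t; rewrite /= /S fct_sumE mulrC.
have bound n : (0 < n)%N ->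
    (P [set t | (e <= `|n%:R^-1 * \sum_(k < n) Z k t - m|)%R]
       <= (e ^- 2 * (v / n%:R))%:E)%E.
  move=> n0; have n0R : n%:R != 0 :> R by rewrite pnatr_eq0 -lt0n.
  have mavg : n%:R^-1 \o* S n \in mfun.
    have := Lfun_scale n%:R^-1 (ler1n R 2) (LS n); exact: sub_Lfun_mfun.
  pose A : {RV P >-> R} := mfun_Sub mavg.
  have EA : 'E_P[A]%E = m%:E.
    by rewrite /= expectationZl ?Lfun_subset12// ES -EFinM mulKf.
  have VA : 'V_P[A]%E = (v / n%:R)%:E.
    rewrite /= varianceZ// (variance_sum_uncorrelated _ LZ cZ vZ) -EFinM; congr EFin.
    by field.
  have := chebyshev A e0; rewrite EA VA /= -EFinM.
  rewrite (_ : [set x | _] = [set t | e <= `|n%:R^-1 * \sum_(k < n) Z k t - m|])//.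
  by apply/seteqP; split=> t /=; rewrite /S fct_sumE mulrC.
apply: (@squeeze_cvge _ _ _ _ (cst 0%E) _ (fun n => (e ^- 2 * (v / n%:R))%:E)).
- near=> n; rewrite measure_ge0 bound//; near: n; exact: nbhs_infty_gt.
- exact: cvg_cst.
apply: cvg_EFin; first exact: nearW.
rewrite (_ : fine \o _ = (fun n => e ^- 2 * v * n%:R^-1)); last first.
  by apply/funext => n /=; rewrite mulrA.
rewrite -[X in _ --> X](mulr0 (e ^- 2 * v)).
apply: cvgM; first exact: cvg_cst.
rewrite -cvg_shiftS; exact: cvg_harmonic.
Unshelve. all: by end_near.
Qed.

End WeakLaw.

(** * Calculus relative to an interval *)

Section IncreasingPrimitive.
Context {R : realType}.
Implicit Types (J : set R) (f g h H : R -> R).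

(** The increment of [g] is the difference quotient, which converges, times
    [y - x], which vanishes. *)
Lemma derivable_in_continuous J g :
  (forall x, J x -> derivable_in J g x) -> {within J, continuous g}.
Proof.
move=> dg; apply/subspace_continuousP => x Jx.
have gx : g y @[y --> within J x^'] --> g x.
  have prod : difference_quotient g x y * (y - x) @[y --> within J x^'] -->
      lim (difference_quotient g x @ within J x^') * (x - x).
    apply: cvgM; first exact: dg.
    apply: cvgB; last exact: cvg_cst.
    by do 2 apply: cvg_within_filter; exact: cvg_id.
  rewrite subrr mulr0 in prod.
  rewrite -[X in _ --> X]add0r; apply: cvg_trans (cvgD prod (cvg_cst (g x))).
  apply: near_eq_cvg; rewrite near_withinE near_withinE; apply: nearW => y yx _.
  by rewrite !fctE /difference_quotient divfK ?subrK// subr_eq0.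
apply/cvgrPdist_lt => e e0; have /cvgrPdist_lt/(_ e e0) := gx.
rewrite !near_withinE; apply: filterS => y gy Jy.
have [->|yx] := eqVneq y x; first by rewrite subrr normr0.
exact: gy.
Qed.

Lemma interval_nbhs J a b x :
  is_interval J -> J a -> J b -> a < x < b -> nbhs x J.
Proof.
move=> iJ Ja Jb /andP[ax xb].
have : nbhs x (`]a, b[%classic : set R).
  by apply: open_nbhs_nbhs; split; [exact: interval_open|rewrite /= in_itv/= ax xb].
apply: filterS => y /=; rewrite in_itv/= => /andP[ay yb].
by apply: (iJ a b) => //; rewrite !ltW.
Qed.

(** At an interior point, limits along [J] are ordinary limits; this gives
    access to the mean value theorem on open subintervals. *)
Lemma derive_in_interior J g x : nbhs x J -> derivable_in J g x ->
  is_derive x 1 g (derive_in J g x).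
Proof.
move=> Jx dg; set l := derive_in J g x.
have dl : difference_quotient g x @ x^' --> l.
  apply/cvgrPdist_lt => e e0; have /cvgrPdist_lt/(_ e e0) := dg.
  rewrite !near_withinE; apply: filterS2 Jx => y Jy dy yx.
  exact: dy.
have ql : t^-1 *: ((g \o shift x) (t *: 1) - g x) @[t --> 0^'] --> l.
  apply/cvgrPdist_lt => e e0.
  move/cvgrPdist_lt/(_ e e0) : dl.
  rewrite !near_withinE /= => /nbhs_ballP[r /= r0 rx].
  apply/nbhs_ballP; exists r => //= t; rewrite /ball/= sub0r normrN => tr t0.
  have /= := rx (t + x).
  rewrite /ball/= opprD addrCA subrr addr0 normrN => /(_ tr).
  rewrite -subr_eq0 addrK => /(_ t0).
  by rewrite /difference_quotient addrK [t *: 1]mulr1 mulrC.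
apply: DeriveDef; first by apply/cvg_ex; exists l.
exact: cvg_lim.
Qed.

Lemma primitive_in_lt J f h : is_interval J -> (forall x, J x -> 0 < f x) ->
  primitive_in J f h -> forall x y, J x -> J y -> x < y -> h x < h y.
Proof.
move=> iJ f0 hf a b Ja Jb ab.
have Jab x : x \in `[a, b] -> J x by rewrite in_itv /= => /(iJ a b _ _); apply.
have dab x : x \in `]a, b[ -> is_derive x 1 h (f x).
  move=> xab; have Jx := Jab x (subset_itv_oo_cc xab).
  have [dx <-] := hf x Jx; apply: derive_in_interior => //.
  by apply: interval_nbhs Ja Jb _ => //; rewrite in_itv/= in xab.
have cab : {within `[a, b], continuous h}.
  apply: (@continuous_subspaceW _ _ _ J); first by move=> x; exact: Jab.
  by apply: derivable_in_continuous => x Jx; case: (hf x Jx).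
have [c cab' hab] := MVT ab dab cab.
rewrite -subr_gt0 hab mulr_gt0 ?subr_gt0//; apply: f0.
exact: Jab (subset_itv_oo_cc cab').
Qed.

Lemma continuous_image_interval J h : is_interval J ->
  {within J, continuous h} -> is_interval (h @` J).
Proof.
move=> iJ ch _ _ [x Jx <-] [y Jy <-] v /andP[xv vy].
have Jxy z a b : J a -> J b -> z \in `[a, b] -> J z.
  by move=> Ja Jb; rewrite in_itv /= => zab; exact: (iJ a b).
have cab a b : J a -> J b -> {within `[a, b], continuous h}.
  move=> Ja Jb; apply: continuous_subspaceW ch => z; exact: Jxy.
have [xy|/ltW yx] := leP x y.
- have [|z zxy <-] := IVT xy (cab _ _ Jx Jy) (v := v).
    by rewrite ge_min xv le_max vy orbT.
  by exists z => //; exact: Jxy zxy.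
- have [|z zyx <-] := IVT yx (cab _ _ Jy Jx) (v := v).
    by rewrite ge_min xv orbT le_max vy.
  by exists z => //; exact: Jxy zyx.
Qed.

(** By monotonicity, [h] separates [x] from the points of [J] at distance at
    least [e] by at least the gap between [h x] and [h (x + e)] or [h (x - e)]. *)
Lemma inverse_increasing_continuous J h H : is_interval J ->
    (forall x y, J x -> J y -> x < y -> h x < h y) ->
    (forall x, J x -> H (h x) = x) ->
  forall x e, J x -> 0 < e -> exists2 r : R, 0 < r &
    forall v, (h @` J) v -> `|v - h x| < r -> `|H v - x| < e.
Proof.
move=> iJ hlt Hh x e Jx e0.
have [r1 r10 Hr1] : exists2 r : R, 0 < r &
    forall y, J y -> h y - h x < r -> y - x < e.
  have [Jxe|Jxe] := pselect (J (x + e)).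
    exists (h (x + e) - h x); first by rewrite subr_gt0 hlt// ltrDl.
    move=> y Jy; rewrite ltrD2r ltrBlDl => yh; rewrite ltNge.
    apply/negP; rewrite le_eqVlt => /predU1P[xey|xey].
      by rewrite xey ltxx in yh.
    by have := lt_trans yh (hlt _ _ Jxe Jy xey); rewrite ltxx.
  (* Here no point of [J] lies at or beyond [x + e], so any radius will do. *)
  exists 1 => // y Jy _; rewrite ltrBlDl ltNge; apply/negP => xey; apply: Jxe.
  by apply: (iJ x y) => //; rewrite xey lerDl ltW.
have [r2 r20 Hr2] : exists2 r : R, 0 < r &
    forall y, J y -> h x - h y < r -> x - y < e.
  have [Jxe|Jxe] := pselect (J (x - e)).
    exists (h x - h (x - e)); first by rewrite subr_gt0 hlt// ltrBlDr ltrDl.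
    move=> y Jy; rewrite ltrD2l ltrN2 ltrBlDl -ltrBlDr => yh; rewrite ltNge.
    apply/negP; rewrite le_eqVlt => /predU1P[xey|xey].
      by rewrite -xey ltxx in yh.
    by have := lt_trans yh (hlt _ _ Jy Jxe xey); rewrite ltxx.
  exists 1 => // y Jy _; rewrite ltrBlDl -ltrBlDr ltNge; apply/negP => xey.
  by apply: Jxe; apply: (iJ y x) => //; rewrite xey gerBl ltW.
exists (Num.min r1 r2); first by rewrite lt_min r10 r20.
move=> _ [y Jy <-]; rewrite Hh// lt_min => /andP[yr1 yr2].
rewrite ltr_norml ltrNl opprB Hr1 ?Hr2//.
  by rewrite (le_lt_trans (ler_norm _))// distrC.
by rewrite (le_lt_trans (ler_norm _)).
Qed.

End IncreasingPrimitive.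

(** * Averages and expectations stay in an interval *)

Section ExpectationInInterval.
Context d (T : measurableType d) (R : realType) (P : probability T R).
Implicit Types (Y : T -> R) (I : set R).

(** Otherwise [Y] would vanish almost everywhere, so the whole space would be
    negligible. *)
Lemma expectation_gt0 Y : Y \in Lfun P 1 -> (forall t, 0 < Y t) ->
  0 < fine 'E_P[Y]%E.
Proof.
move=> LY Y0.
have mY : measurable_fun [set: T] (EFin \o Y).
  by have /Lfun1_integrable/integrableP[] := LY.
rewrite lt_neqAle fine_ge0 ?expectation_ge0// ?andbT => [|t]; last exact/ltW.
apply/eqP => /esym EY0.
have : (\int[P]_t `|(EFin \o Y) t| = 0)%E.
  rewrite -[RHS]/(0%:E) -EY0 fineK ?expectation_fin_num// unlock.
  by apply: eq_integral => t _; rewrite /= gtr0_norm.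
move/(ae_eq_integral_abs P measurableT mY) => [N [mN PN sub]].
have NT : N = setT.
  apply/seteqP; split=> // t _; apply: sub => /(_ Logic.I)[Yt0].
  by have := Y0 t; rewrite Yt0 ltxx.
by have := probability_setT P; rewrite -NT PN => -[] /eqP; rewrite eq_sym oner_eq0.
Qed.

(** If the mean [m] were outside [I], convexity of [I] would put all values of
    [Y] strictly on the same side of [m], and then [Y - m] or [m - Y] would be
    positive with zero expectation. *)
Lemma expectation_in_interval I Y : is_interval I -> Y \in Lfun P 1 ->
  (forall t, I (Y t)) -> I (fine 'E_P[Y]%E).
Proof.
move=> iI LY IY; set m := fine _; apply: contrapT => nIm.
have Lm : cst m \in Lfun P 1 by exact: Lfun_cst.
have neq t : Y t != m by apply: contra_not_neq nIm => <-.
have finY := expectation_fin_num LY.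
have [[t0 t0m]|/forallNP ge] := pselect (exists t, Y t < m).
  have lt t : Y t < m.
    rewrite ltNge; apply/negP => mt; apply: nIm.
    by apply: (iI (Y t0) (Y t)) => //; rewrite ltW.
  have : 0 < fine 'E_P[cst m \- Y]%E.
    by apply: expectation_gt0 => [|t]; rewrite ?rpredB//= subr_gt0.
  by rewrite expectationB// expectation_cst -(fineK finY) /= subrr ltxx.
have : 0 < fine 'E_P[Y \- cst m]%E.
  apply: expectation_gt0 => [|t]; rewrite ?rpredB//= subr_gt0.
  by rewrite lt_neqAle eq_sym neq /= leNgt; apply/negP/ge.
by rewrite expectationB// expectation_cst -(fineK finY) /= subrr ltxx.
Qed.

(** By induction: the average of [n + 2] values is a convex combination of the
    average of the first [n + 1] and of the last one. *)
Lemma average_in_interval I (z : nat -> R) n : is_interval I ->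
  (forall k, I (z k)) -> I (n.+1%:R^-1 * \sum_(k < n.+1) z k).
Proof.
move=> iI Iz; elim: n => [|n IH].
  by rewrite big_ord_recr big_ord0 /= add0r invr1 mul1r.
rewrite big_ord_recr /=.
set a := n.+1%:R^-1 * _ in IH; set s := \sum_(_ < _) _ in a IH *.
have sE : s = n.+1%:R * a by rewrite /a mulVKf// pnatr_eq0.
have n0 : 0 < n.+2%:R :> R by rewrite ltr0n.
rewrite mulrC sE -[n.+2%:R]natr1.
have [az|/ltW za] := leP a (z n.+1).
  apply: (iI a (z n.+1)) => //.
  rewrite ler_pdivlMr ?ler_pdivrMr ?natr1//.
  rewrite -natr1 !mulrDr !mulr1 mulrC lerD2l az /=.
  by rewrite lerD2r mulrC ler_wpM2r.
apply: (iI (z n.+1) a) => //.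
rewrite ler_pdivlMr ?ler_pdivrMr ?natr1//.
rewrite -natr1 !mulrDr !mulr1 lerD2r mulrC ler_wpM2l//=.
by rewrite mulrC lerD2l.
Qed.

End ExpectationInInterval.

(** * Convergence in probability *)

Section ConvergenceInProbability.
Context d (T : measurableType d) (R : realType) (P : probability T R).

(** Used to discard the empty sample, whose average is [0] by convention and may
    lie outside [h(J)]. *)
Lemma converges_in_probabilityS (V : Type) (dist : V -> V -> R)
    (Y : nat -> T -> V) c :
  converges_in_probability P dist (fun n => Y n.+1) c ->
  converges_in_probability P dist Y c.
Proof. by move=> Yc e e0; rewrite -cvg_shiftS; exact: Yc. Qed.

Lemma measurable_superlevel (f : T -> R) (e : R) : measurable_fun [set: T] f ->
  measurable [set t | e <= f t].
Proof.
move=> mf; have := mf measurableT `[e, +oo[%classic (measurable_itv _).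
rewrite setTI; congr measurable; apply/seteqP; split=> t /=;
by rewrite in_itv /= andbT.
Qed.

Lemma measurable_tail (Y : T -> R) (m e : R) : measurable_fun [set: T] Y ->
  measurable [set t | e <= `|Y t - m|].
Proof.
move=> mY; apply: measurable_superlevel.
by apply: measurableT_comp => //; exact: measurable_funB.
Qed.

Lemma measurable_euclidean_dist (K : nat) (Y : T -> K.-tuple R) c :
    (forall i, measurable_fun [set: T] (fun t => tnth (Y t) i)) ->
  measurable_fun [set: T] (fun t => euclidean_dist (Y t) c).
Proof.
move=> mY; apply: (@measurableT_comp _ _ _ _ _ _ (@Num.sqrt R)).
  by apply: continuous_measurable_fun; exact: sqrt_continuous.
by apply: measurable_sum => i; apply: measurable_funX; exact: measurable_funB.
Qed.

Lemma Lfun2_tnth (K : nat) (Y : T -> K.-tuple R) c i :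
    (forall i, measurable_fun [set: T] (fun t => tnth (Y t) i)) ->
    ('E_P[fun t => (euclidean_dist (Y t) c ^+ 2)%R] < +oo)%E ->
  (fun t => tnth (Y t) i) \in Lfun P 2%:E.
Proof.
move=> mY finY; pose Z t := tnth (Y t) i - tnth c i.
have mZ : measurable_fun [set: T] Z by exact: measurable_funB.
rewrite (_ : (fun t => _) = Z + cst (tnth c i)); last first.
  by apply/funext => t; rewrite fctE subrK.
rewrite rpredD ?lee1n// => ge12; last exact: Lfun_cst.
apply: Lfun2_sqr_integrable => //.
apply: le_lt_trans finY; rewrite unlock; apply: ge0_le_integral => //.
- by move=> t _; rewrite lee_fin sqr_ge0.
- by apply/measurable_EFinP; exact: measurable_funX.
- apply/measurable_EFinP; apply: measurable_funX.
  exact: measurable_euclidean_dist.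
- move=> t _; rewrite lee_fin /euclidean_dist sqr_sqrtr; last first.
    by apply: sumr_ge0 => j _; exact: sqr_ge0.
  by rewrite (bigD1 i)//= lerDl; apply: sumr_ge0 => j _; exact: sqr_ge0.
Qed.

Lemma continuous_mapping (I : set R) (Z : nat -> T -> R) (m : R) (H : R -> R) :
    (forall n, measurable_fun [set: T] (Z n)) ->
    (forall n, measurable_fun [set: T] (H \o Z n)) ->
    (forall n t, I (Z n t)) ->
    (forall e, 0 < e -> exists2 r : R, 0 < r &
       forall v, I v -> `|v - m| < r -> `|H v - H m| < e) ->
    converges_in_probability P (fun x y => `|x - y|) Z m ->
  converges_in_probability P (fun x y => `|x - y|) (fun n t => H (Z n t)) (H m).
Proof.
move=> mZ mHZ IZ cH Zm e e0; have [r r0 Hr] := cH e e0.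
apply: (@squeeze_cvge _ _ _ _ (cst 0%E) _ (fun n => P [set t | r <= `|Z n t - m|])).
- apply: nearW => n; rewrite measure_ge0 le_measure ?inE//.
  + exact: (measurable_tail _ _ (mHZ n)).
  + exact: measurable_tail.
  + move=> t /=; rewrite !leNgt; apply: contra; exact: Hr.
- exact: cvg_cst.
- exact: Zm.
Qed.

(** If the distance is at least [e], then some coordinate deviates by at least
    [r = e / (K + 1)], for otherwise the squared distance would be at most
    [K * r ^+ 2 < e ^+ 2]; the probabilities of these [K] deviations add up to a
    quantity that tends to [0]. *)
Lemma converges_in_probability_coordinates (K : nat)
    (Y : nat -> T -> K.-tuple R) (c : K.-tuple R) :
    (forall n i, measurable_fun [set: T] (fun t => tnth (Y n t) i)) ->
    (forall i, converges_in_probability P (fun x y => `|x - y|)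
                 (fun n t => tnth (Y n t) i) (tnth c i)) ->
  converges_in_probability P euclidean_dist Y c.
Proof.
move=> mY Yc e e0; have [r r0 eE] : exists2 r, 0 < r & e = r * K.+1%:R.
  by exists (e / K.+1%:R); rewrite ?divr_gt0// divfK// pnatr_eq0.
pose A n (i : 'I_K) := [set t | r <= `|tnth (Y n t) i - tnth c i|].
have mA n i : measurable (A n i) by exact: measurable_tail.
have mD n : measurable [set t | e <= euclidean_dist (Y n t) c].
  by apply: measurable_superlevel; exact: measurable_euclidean_dist.
pose D := [set` index_enum 'I_K].
have sub n : [set t | e <= euclidean_dist (Y n t) c] `<=` \bigcup_(i in D) A n i.
  move=> t /=; apply: contraPP => nA; apply/negP; rewrite -ltNge.
  have small i : `|tnth (Y n t) i - tnth c i| < r.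
    rewrite ltNge; apply/negP => ri; apply: nA; exists i => //.
    by rewrite /D /= mem_index_enum.
  rewrite /euclidean_dist -[ltRHS]gtr0_norm// -sqrtr_sqr ltr_sqrt ?exprn_gt0//.
  apply: (@le_lt_trans _ _ (\sum_(i < K) r ^+ 2)).
    apply: ler_sum => i _; rewrite -real_normK ?num_real//.
    by rewrite lerXn2r ?nnegrE// ltW// small.
  rewrite sumr_const card_ord eE exprMn -[_ ^+ 2 *+ K]mulr_natr ltr_pM2l ?exprn_gt0//.
  rewrite -natrX ltr_nat.
  by rewrite (@leq_trans K.+1)// expnS leq_pmulr// expn1.
apply: (@squeeze_cvge _ _ _ _ (cst 0%E) _ (fun n => \sum_(i < K) P (A n i))%E).
- apply: nearW => n; rewrite measure_ge0 /=.
  rewrite fsbig_seq ?index_enum_uniq//.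
  by apply: content_sub_fsum => //; exact: finite_seq.
- exact: cvg_cst.
- rewrite [X in _ --> X](_ : _ = \sum_(i < K) 0)%E; last by rewrite big1.
  apply: cvg_nnesum => i _.
    exact: nearW.
  exact: Yc.
Qed.

End ConvergenceInProbability.

(** * Weak law for independent, identically distributed variables *)

Section IndependentIdenticallyDistributed.
Context d d' (T : measurableType d) (V : measurableType d') (R : realType).
Variable P : probability T R.
Implicit Types (U W : {RV P >-> V}) (f : V -> R).

Lemma identically_distributed_Lfun2 U W f : identically_distributed U W ->
    measurable_fun [set: V] f ->
  f \o W \in Lfun P 2%:E -> f \o U \in Lfun P 2%:E.
Proof.
move=> UW mf LW; have mf2 : measurable_fun [set: V] (fun v => (f v ^+ 2)%:E).
  by apply/measurable_EFinP; exact: measurable_funX.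
have f2ge0 v : (0 <= (f v ^+ 2)%:E)%E by rewrite lee_fin sqr_ge0.
apply: Lfun2_sqr_integrable; first exact: measurableT_comp.
have /integrableP[_] := Lfun2_integrable_sqr LW.
under eq_integral do rewrite /= ger0_norm ?sqr_ge0//.
rewrite -(ge0_integral_distribution W mf2 f2ge0).
rewrite -(ge0_integral_distribution U mf2 f2ge0).
by rewrite (@eq_measure_integral _ _ _ _ (distribution P U))// => A mA _;
  exact/esym/UW.
Qed.

Lemma identically_distributed_expectation U W f : identically_distributed U W ->
    measurable_fun [set: V] f -> f \o U \in Lfun P 1 -> f \o W \in Lfun P 1 ->
  ('E_P[f \o U] = 'E_P[f \o W])%E.
Proof.
move=> UW mf /Lfun1_integrable iU /Lfun1_integrable iW.
have mEf : measurable_fun [set: V] (EFin \o f) by exact/measurable_EFinP.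
rewrite unlock -(integral_distribution (X := U) mEf)//.
rewrite -(integral_distribution (X := W) mEf)//.
by apply: eq_measure_integral => A mA _; exact: UW.
Qed.

Lemma weak_law_iid (X : nat -> {RV P >-> V}) (X0 : {RV P >-> V}) f :
    mutually_independent X -> (forall k, identically_distributed (X k) X0) ->
    measurable_fun [set: V] f -> f \o X0 \in Lfun P 2%:E ->
  converges_in_probability P (fun x y => `|x - y|)
    (fun n t => n%:R^-1 * \sum_(k < n) f (X k t)) (fine 'E_P[f \o X0]%E).
Proof.
move=> indX idX mf L0.
have PT : P [set: T] \is a fin_num by exact: fin_num_measure.
have LX k : f \o X k \in Lfun P 2%:E.
  exact: identically_distributed_Lfun2 (idX k) mf L0.
have L1 k : f \o X k \in Lfun P 1 by rewrite Lfun_subset12.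
have EX k : ('E_P[f \o X k] = 'E_P[f \o X0])%E.
  by apply: identically_distributed_expectation; rewrite ?Lfun_subset12.
have VX k : ('V_P[f \o X k] = 'V_P[f \o X0])%E.
  rewrite !varianceE// EX; congr (_ - _)%E.
  apply: (@identically_distributed_expectation (X k) X0 (fun v => f v ^+ 2)) => //.
  - exact: measurable_funX.
  - by apply/Lfun1_integrable; exact: Lfun2_integrable_sqr (LX k).
  - by apply/Lfun1_integrable; exact: Lfun2_integrable_sqr L0.
apply: (@weak_law_of_large_numbers _ _ _ P (fun k => f \o X k) _
  (fine 'V_P[f \o X0]%E)) => // [j k jk|k|k].
- have Ljk := Lfun2_mul_Lfun1 (LX j) (LX k).
  rewrite covarianceE ?L1// expectation_mul_independent ?L1//.
    by rewrite subee// fin_numM ?expectation_fin_num ?L1.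
  by move=> A B mA mB; exact: mutually_independent_pair.
- by rewrite fineK ?EX// expectation_fin_num// Lfun_subset12.
- by rewrite fineK ?VX// variance_fin_num.
Qed.

End IndependentIdenticallyDistributed.

(** * The law of large numbers for the d-mean *)

Theorem theorem4p1 (R : realType) (J : set R) (phi h H : R -> R) (K : nat)
    (d : measure_display) (T : measurableType d) (P : probability T R)
    (X0 : {RV P >-> K.-tuple R}) (X : nat -> {RV P >-> K.-tuple R})
    (interval_J : nondegenerate_interval J)
    (convex_phi : strictly_convex_in J phi)
    (smooth_phi : continuously_derivable_in J 3 phi)
    (phi2_gt0 : forall x, J x -> 0 < deriven_in J 2 phi x)
    (primitive_h : primitive_in J (fun x => Num.sqrt (deriven_in J 2 phi x)) h)
    (inverse_H : forall x, J x -> H (h x) = x)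
    (X0_in_M : forall t, cartesian_power J (X0 t))
    (X_in_M : forall k t, cartesian_power J (X k t))
    (independent_X : mutually_independent X)
    (distributed_X : forall k, identically_distributed (X k) X0)
    (finite_variance : (d_variance P h H X0 < +oo)%E) :
  converges_in_probability P (geodesic_dist h)
    (sample_d_mean h H (fun k => X k)) (d_mean P h H X0) /\
  converges_in_probability P euclidean_dist
    (sample_d_mean h H (fun k => X k)) (d_mean P h H X0).
Proof.
have [iJ _] := interval_J.
have h_lt : forall x y, J x -> J y -> x < y -> h x < h y.
  by apply: (primitive_in_lt iJ _ primitive_h) => x Jx; rewrite sqrtr_gt0 phi2_gt0.
have ch : {within J, continuous h}.
  by apply: derivable_in_continuous => x Jx; case: (primitive_h x Jx).
pose hJ := h @` J.
have ihJ : is_interval hJ := continuous_image_interval iJ ch.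
have mJ : measurable J := is_interval_measurable iJ.
have mhJ : measurable hJ := is_interval_measurable ihJ.
have mh : measurable_fun J h by exact: subspace_continuous_measurable_fun.
have cH m e : hJ m -> 0 < e -> exists2 r : R, 0 < r &
    forall v, hJ v -> `|v - m| < r -> `|H v - H m| < e.
  move=> [x Jx <-] e0; rewrite inverse_H//.
  exact: (inverse_increasing_continuous iJ h_lt inverse_H).
have mH : measurable_fun hJ H.
  apply: subspace_continuous_measurable_fun => //.
  apply/subspace_continuousP => m hm; apply/cvgrPdist_lt => e e0.
  have [r r0 Hr] := cH m e hm e0.
  rewrite near_withinE; apply/nbhs_ballP; exists r => //= v mv hv.
  by rewrite distrC Hr// distrC.
(* [h] is measurable on [J]; its extension by [0] is measurable everywhere and
   agrees with [h] on the values of the samples. *)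
pose f i : K.-tuple R -> R := fun v => (h \_ J) (tnth v i).
have mf i : measurable_fun [set: K.-tuple R] (f i).
  apply: (@measurableT_comp _ _ _ _ _ _ (h \_ J)); last exact: measurable_tnth.
  exact/(measurable_restrictT h mJ).
have fE i v : cartesian_power J v -> f i v = tnth (map_tuple h v) i.
  by move=> Jv; rewrite /f tnth_map patchE mem_set//; exact: Jv.
have hX0E i : (fun t => tnth (map_tuple h (X0 t)) i) = f i \o X0.
  by apply/funext => t; rewrite /= fE.
have Lf i : f i \o X0 \in Lfun P 2%:E.
  rewrite -hX0E; apply: Lfun2_tnth finite_variance => j.
  by rewrite hX0E; exact: measurableT_comp.
(* The sample has size [n.+1], so that its average lies in [h(J)]. *)
pose avg n t := sample_average n.+1 (fun k => map_tuple h (X k t)).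
pose mu := mean_vector P (fun t => map_tuple h (X0 t)).
have muE i : tnth mu i = fine 'E_P[f i \o X0]%E.
  by rewrite tnth_mktuple hX0E.
have avgE n i : (fun t => tnth (avg n t) i) =
    (fun t => n.+1%:R^-1 * \sum_(k < n.+1) f i (X k t)).
  apply/funext => t; rewrite tnth_mktuple; congr (_ * _).
  by apply: eq_bigr => k _; rewrite fE.
have mavg n i : measurable_fun [set: T] (fun t => tnth (avg n t) i).
  rewrite avgE; apply: measurable_funM => //; apply: measurable_sum => k.
  exact: measurableT_comp.
have havg n t i : hJ (tnth (avg n t) i).
  rewrite tnth_mktuple; apply: (average_in_interval
    (z := fun k => tnth (map_tuple h (X k t)) i)) => // k.
  by rewrite tnth_map; exists (tnth (X k t) i) => //; exact: X_in_M.
have hmu i : hJ (tnth mu i).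
  rewrite muE; apply: expectation_in_interval => //.
    by rewrite Lfun_subset12 ?fin_num_measure.
  by move=> t; rewrite /= fE// tnth_map; exists (tnth (X0 t) i) => //; exact: X0_in_M.
have cavg i : converges_in_probability P (fun x y => `|x - y|)
    (fun n t => tnth (avg n t) i) (tnth mu i).
  rewrite muE (_ : (fun n t => _) =
      (fun n t => n.+1%:R^-1 * \sum_(k < n.+1) f i (X k t))); last first.
    by apply/funext => n; exact: avgE.
  move=> e e0; have := weak_law_iid independent_X distributed_X (mf i) (Lf i) e0.
  by rewrite -cvg_shiftS.
have hHt (v : K.-tuple R) : (forall i, hJ (tnth v i)) ->
    map_tuple h (map_tuple H v) = v.
  move=> hv; apply: eq_from_tnth => i; rewrite !tnth_map.
  by have [x Jx <-] := hv i; rewrite inverse_H.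
have geoE n t : geodesic_dist h (sample_d_mean h H (fun k => X k) n.+1 t)
    (d_mean P h H X0) = euclidean_dist (avg n t) mu.
  by congr (euclidean_dist _ _); apply: hHt => i; [exact: havg|exact: hmu].
have mHavg n i : measurable_fun [set: T] (H \o (fun t => tnth (avg n t) i)).
  rewrite (_ : _ \o _ = (H \_ hJ) \o (fun t => tnth (avg n t) i)); last first.
    by apply/funext => t; rewrite /= patchE mem_set.
  by apply: measurableT_comp => //; exact/(measurable_restrictT H mhJ).
split; apply: converges_in_probabilityS.
- move=> e e0; have := converges_in_probability_coordinates mavg cavg e0.
  rewrite (_ : (fun n => P _) = (fun n => P [set t | e <= geodesic_dist h
    (sample_d_mean h H (fun k => X k) n.+1 t) (d_mean P h H X0)])) => [//|].
  by apply/funext => n; congr (P _); apply/seteqP; split=> t /=; rewrite geoE.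
- apply: converges_in_probability_coordinates => [n i|i].
    rewrite (_ : (fun t => _) = H \o (fun t => tnth (avg n t) i)) => [//|].
    by apply/funext => t; rewrite tnth_map.
  rewrite (_ : (fun n t => _) = (fun n t => H (tnth (avg n t) i))); last first.
    by apply/funext => n; apply/funext => t; rewrite tnth_map.
  rewrite tnth_map; apply: (continuous_mapping (I := hJ)) => //.
  + by move=> e; exact: cH.
Qed.
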